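(* Let $X$ be a uniformly locally finite CAT(0) cube complex without cut vertex. Then the crossing graph $\Delta X$ is a quasi-tree.
   Context: A cube complex is uniformly locally finite if there is a uniform bound on the number of neighbors of its vertices. A cut vertex is a vertex whose removal disconnects $X$. A hyperplane is an equivalence class of edges for the transitive closure of the relation identifying parallel edges of squares; two distinct hyperplanes are transverse if they contain two non-parallel edges of a common square. The crossing graph $\Delta X$ is the graph whose vertices are the hyperplanes of $X$ and whose edges link two transverse hyperplanes. A quasi-tree is a connected graph which, endowed with its graph metric, is quasi-isometric to a tree. *)

(* Defs.v *)
From HB Require Import structures.
From Stdlib Require Import Relation_Operators.
From mathcomp Require Import all_boot all_order all_algebra.
From mathcomp Require Import boolp classical_sets functions cardinality reals.

Set Implicit Arguments.
Unset Strict Implicit.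
Unset Printing Implicit Defensive.

Import Order.TTheory GRing.Theory Num.Theory.

Local Open Scope classical_set_scope.
Local Open Scope card_scope.

Definition cvertex (n : nat) := {ffun 'I_n -> bool}.

Definition hamming n (x y : cvertex n) : nat := #|[set i | x i != y i]%SET|.

(* The Hamming-isometric maps {0,1}^m -> {0,1}^n are exactly the restrictions to
   the vertices of the isometries of [0,1]^m onto the m-dimensional faces of
   [0,1]^n. *)
Definition isometric m n (f : {ffun cvertex m -> cvertex n}) : bool :=
  [forall x, forall y, hamming (f x) (f y) == hamming x y].

Definition cmap m n := {f : {ffun cvertex m -> cvertex n} | isometric f}.

Definition Cmap m n (f : {ffun cvertex m -> cvertex n}) (hf : isometric f) :
  cmap m n := exist (fun g => is_true (isometric g)) f hf.

Lemma cid_isometric n : isometric [ffun x : cvertex n => x].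
Proof. by apply/forallP => x; apply/forallP => y; rewrite !ffunE. Qed.

Definition cid n : cmap n n := Cmap (cid_isometric n).

Lemma ccomp_isometric k m n (f : cmap m n) (g : cmap k m) :
  isometric [ffun x => sval f (sval g x)].
Proof.
apply/forallP => x; apply/forallP => y; rewrite !ffunE.
case: f g => [f hf] [g hg] /=.
by rewrite (eqP (forallP (forallP hf _) _)) (forallP (forallP hg _) _).
Qed.

Definition ccomp k m n (f : cmap m n) (g : cmap k m) : cmap k n :=
  Cmap (ccomp_isometric f g).

Lemma at_vertex_isometric n (x : cvertex n) :
  isometric [ffun _ : cvertex 0 => x].
Proof.
apply/forallP => y; apply/forallP => z; rewrite !ffunE /hamming.
apply/eqP; rewrite [RHS]eq_card0; last by case.
by apply: eq_card0 => i; rewrite inE eqxx.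
Qed.

Definition at_vertex n (x : cvertex n) : cmap 0 n :=
  Cmap (at_vertex_isometric x).

Lemma along_isometric n (i : 'I_n) (x : cvertex n) :
  isometric [ffun t : cvertex 1 => [ffun j => if j == i then t ord0 else x j]].
Proof.
apply/forallP => s; apply/forallP => t; rewrite !ffunE /hamming.
case: (eqVneq (s ord0) (t ord0)) => hst.
  apply/eqP; rewrite !eq_card0 // => j; rewrite !inE ?ffunE.
    by rewrite (ord1 j) hst eqxx.
  by case: ifP => _; rewrite ?hst eqxx.
apply/eqP; rewrite (eq_card (B := pred1 i)) ?card1 => [|j].
  rewrite (eq_card (B := pred1 ord0)) ?card1 // => j.
  by rewrite !inE (ord1 j) hst eqxx.
by rewrite !inE !ffunE; case: (j == i); rewrite ?hst ?eqxx.
Qed.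

(* The edge of the n-cube in direction i through x, oriented so that its i-th
   coordinate goes from 0 to 1. *)
Definition along n (i : 'I_n) (x : cvertex n) : cmap 1 n :=
  Cmap (along_isometric i x).

Lemma cflip_isometric :
  isometric [ffun t : cvertex 1 => [ffun j => ~~ t j] : cvertex 1].
Proof.
apply/forallP => s; apply/forallP => t; rewrite !ffunE /hamming.
by apply/eqP; apply: eq_card => j; rewrite !inE !ffunE (inj_eq negb_inj).
Qed.

Definition cflip : cmap 1 1 := Cmap cflip_isometric.

Definition czero n : cvertex n := [ffun _ => false].
Definition cone n : cvertex n := [ffun _ => true].

(* A complex obtained by gluing cubes along faces by isometries is recorded by
   its charts: [cube n] is the set of the characteristic maps of the n-cubes,
   each cube being counted with all the 2^n n! identifications with [0,1]^n.
   Thus an element of [cube 0] is a vertex, an element of [cube 1] is an oriented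
   edge, and [face f c] is the restriction of the chart c to the face f.  Cubes
   are neither required to be embedded nor determined by their vertices.
   [face_free] says that a cube is not folded, i.e. its 2^n n! charts are
   distinct. *)
Record cubeComplex := CubeComplex {
  cube : nat -> Type;
  face : forall m n, cmap m n -> cube n -> cube m;
  face_id : forall n (c : cube n), face (cid n) c = c;
  face_comp : forall k m n (f : cmap m n) (g : cmap k m) (c : cube n),
    face (ccomp f g) c = face g (face f c);
  face_free : forall n (f : cmap n n) (c : cube n), face f c = c -> f = cid n
}.

Definition vertex (X : cubeComplex) := cube X 0.
Definition edge (X : cubeComplex) := cube X 1.

Section CubeComplex.
Variable X : cubeComplex.

Definition corner n (c : cube X n) (x : cvertex n) : vertex X :=
  face (at_vertex x) c.
Definition cedge n (c : cube X n) (i : 'I_n) (x : cvertex n) : edge X :=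
  face (along i x) c.

Definition src (e : edge X) : vertex X := corner e (czero 1).
Definition tgt (e : edge X) : vertex X := corner e (cone 1).
Definition erev (e : edge X) : edge X := face cflip e.

Definition neighbor (v w : vertex X) : Prop :=
  exists e : edge X, src e = v /\ tgt e = w.

End CubeComplex.

Definition uniformly_locally_finite (X : cubeComplex) : Prop :=
  exists N : nat, forall v : vertex X, [set w | neighbor v w] #<= `I_N.

Section Walks.
Variables (V : Type) (E : V -> V -> Prop).

Definition is_walk (n : nat) (p : nat -> V) : Prop :=
  forall i, (i < n)%N -> E (p i) (p i.+1).

Definition joined_in (A : set V) (n : nat) (x y : V) : Prop :=
  exists p : nat -> V, [/\ p 0%N = x, p n = y, is_walk n p
                         & forall i, (i <= n)%N -> A (p i)].

(* The empty subgraph counts as connected. *)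
Definition connected_in (A : set V) : Prop :=
  forall x y, A x -> A y -> exists n, joined_in A n x y.

End Walks.

Definition cut_vertex (X : cubeComplex) (v : vertex X) : Prop :=
  ~ connected_in (@neighbor X) [set w | w <> v].

Section CAT0.
Variable X : cubeComplex.

Fixpoint edge_path (v : vertex X) (s : seq (edge X)) (w : vertex X) : Prop :=
  match s with
  | [::] => v = w
  | e :: s' => src e = v /\ edge_path (tgt e) s' w
  end.

(* Since q ranges over all the charts of the squares, [htpy_square] is available
   from each corner of each square; together with [htpy_backtrack] it kills the
   boundary of every 2-cell. *)
Inductive htpy_step : seq (edge X) -> seq (edge X) -> Prop :=
| htpy_backtrack s t e :
    htpy_step (s ++ e :: erev e :: t) (s ++ t)
| htpy_square s t (q : cube X 2) :
    htpy_step
      (s ++ cedge q ord0 (czero 2) :: cedge q ord_max (cone 2) :: t)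
      (s ++ cedge q ord_max (czero 2) :: cedge q ord0 (cone 2) :: t).

Definition homotopic (v w : vertex X) : seq (edge X) -> seq (edge X) -> Prop :=
  clos_refl_sym_trans _
    (fun s t => [/\ edge_path v s w, edge_path v t w & htpy_step s t]).

(* The edge-path (combinatorial) form of simple connectedness. *)
Definition simply_connected : Prop :=
  connected_in (@neighbor X) setT /\
  forall (v : vertex X) (s : seq (edge X)),
    edge_path v s v -> homotopic v v s [::].

(* The vertices of the link of v are the oriented edges issuing from v; its
   (n-1)-simplices are the charts c of n-cubes with corner c 0 = v, up to
   permutation of the coordinates, c having the vertices [link_vertex c i].
   Every corner of every cube is the origin of one of its charts. *)
Definition link_vertex n (c : cube X n) (i : 'I_n) : edge X :=
  cedge c i (czero n).

(* Charts are compared with labelled vertices: two simplices with the same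
   vertex set have, after permuting coordinates, the same labelled vertices. *)
Definition link_simplicial (v : vertex X) : Prop :=
  (forall n (c : cube X n), corner c (czero n) = v ->
     injective (link_vertex c)) /\
  (forall n (c d : cube X n), corner c (czero n) = v -> corner d (czero n) = v ->
     (forall i, link_vertex c i = link_vertex d i) -> c = d).

Definition link_adjacent (e f : edge X) : Prop :=
  exists q : cube X 2, link_vertex q ord0 = e /\ link_vertex q ord_max = f.

Definition link_flag (v : vertex X) : Prop :=
  forall n (e : 'I_n -> edge X),
    (forall i, src (e i) = v) -> injective e ->
    (forall i j, i != j -> link_adjacent (e i) (e j)) ->
    exists c : cube X n,
      corner c (czero n) = v /\ forall i, link_vertex c i = e i.

Definition nonpositively_curved : Prop :=
  forall v : vertex X, link_simplicial v /\ link_flag v.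

Definition CAT0 : Prop := simply_connected /\ nonpositively_curved.

(* Two orientations of the same edge are identified, as edges are unoriented
   here. *)
Inductive parallel_step : edge X -> edge X -> Prop :=
| parallel_rev e : parallel_step e (erev e)
| parallel_square (q : cube X 2) (i : 'I_2) (x y : cvertex 2) :
    parallel_step (cedge q i x) (cedge q i y).

Definition hyperplane_of (e : edge X) : set (edge X) :=
  [set f | clos_refl_sym_trans _ parallel_step e f].

Definition hyperplane := {H : set (edge X) | exists e, H = hyperplane_of e}.

Definition transverse (H K : hyperplane) : Prop :=
  H <> K /\
  exists (q : cube X 2) (i j : 'I_2) (x y : cvertex 2),
    [/\ i <> j, sval H (cedge q i x) & sval K (cedge q j y)].

Lemma transverse_sym H K : transverse H K -> transverse K H.
Proof.
move=> [HK [q [i [j [x [y [ij Hq Kq]]]]]]]; split; first exact: nesym.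
by exists q, j, i, y, x; split => //; exact: nesym.
Qed.

Lemma transverse_irr H : ~ transverse H H.
Proof. by case. Qed.

End CAT0.

Record graph := Graph {
  gvertex : Type;
  gadj : gvertex -> gvertex -> Prop;
  gadj_sym : forall x y, gadj x y -> gadj y x;
  gadj_irr : forall x, ~ gadj x x
}.

Definition crossing_graph (X : cubeComplex) : graph :=
  Graph (@transverse_sym X) (@transverse_irr X).

Definition gconnected (G : graph) : Prop := connected_in (@gadj G) setT.

Definition is_cycle (G : graph) (n : nat) (p : nat -> gvertex G) : Prop :=
  [/\ (3 <= n)%N, is_walk (@gadj G) n p, p n = p 0%N
    & forall i j, (i < n)%N -> (j < n)%N -> p i = p j -> i = j].

(* As for [gconnected], the empty graph is a tree. *)
Definition is_tree (G : graph) : Prop :=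
  gconnected G /\ forall n p, ~ @is_cycle G n p.

(* The value is 0 if x and y are not joined by a walk; only used in connected
   graphs. *)
Definition gdist (G : graph) (x y : gvertex G) : nat :=
  xget 0%N [set n | joined_in (@gadj G) setT n x y /\
                    forall m, joined_in (@gadj G) setT m x y -> (n <= m)%N].

Local Open Scope ring_scope.

Definition quasi_isometric (R : realType) (T U : Type)
    (dT : T -> T -> R) (dU : U -> U -> R) : Prop :=
  exists (f : T -> U) (L C : R),
    [/\ 1 <= L, 0 <= C,
        forall x y, dT x y / L - C <= dU (f x) (f y) <= L * dT x y + C
      & forall z, exists x, dU (f x) z <= C].

Definition quasi_tree (R : realType) (G : graph) : Prop :=
  gconnected G /\
  exists T : graph, is_tree T /\
    quasi_isometric (fun x y : gvertex G => (gdist x y)%:R : R)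
                    (fun x y : gvertex T => (gdist x y)%:R : R).

(* Main.v *)
Require Import Defs.
From Stdlib Require Import Relation_Operators.
From mathcomp Require Import all_boot all_order all_algebra.
From mathcomp Require Import boolp classical_sets functions cardinality reals.
From mathcomp Require Import zify.

(** The crossing graph is shown to be a quasi-tree by a bottleneck argument
    which only needs the geometry of the 1-skeleton of X.

    Link conditions.  The characteristic maps enter through one relation:
    [sq a b c d] says that the edge paths a b and c d bound a square.
    Nonpositive curvature says that a square is determined by two of its
    consecutive edges ([sq_uniq]), is not folded ([sq_neq]), and that three
    pairwise adjacent squares at a corner span a cube ([sq_cube]).

    Geodesics.  Let two edge paths be equivalent when they differ by pushing
    across squares.  By the cube condition, two equivalent paths with different
    first edges have these edges in a common square through which both can be
    pushed ([exchange]).  Hence adding an edge to a path without removable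
    backtrack, and cancelling it if possible, is well defined up to equivalence
    and compatible with homotopy ([act_square], [nf_homotopic]).  As X is simply
    connected, all reduced paths between two vertices are equivalent, hence they
    are the geodesics.  This gives the quadrangle condition ([quadrangle]) and
    the two sides of a hyperplane: which end of an edge is closer to a vertex
    only depends on the hyperplane of the edge ([closer_parallel]), and changes
    exactly along the edges of this hyperplane ([parallel_of_closer_neq]).

    Links.  If v is not a cut vertex then its link is connected: the first edges
    of the geodesics from v to w are pairwise adjacent in the link, and they stay
    in the same component of the link while w moves without meeting v
    ([link_connected]).  As degrees are at most N, the hyperplanes of two edges
    with a common origin are at distance at most N in the crossing graph
    ([contact_gdist]).

    Bottleneck.  If the hyperplane W separates an edge of H from an edge of K,
    then every walk from H to K in the crossing graph contains W or a neighbor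
    of W ([hyperplane_bottleneck]).  Fix a hyperplane o, and let H and K be at
    the same distance n from o and be joined by a walk staying at distance at
    least n from o.  Any W crossed by a geodesic of X from an edge of H to an
    edge of K separates them, so it is at distance at least n - 1 from o; it also
    separates any edge of o from one of these two edges, so it is at distance at
    most 1 from a geodesic of length n from o to H or K, and is therefore within
    3 of H or K ([separating_close]).
    Consecutive edges of the geodesic are within N, so H and K are within N + 6
    ([piece_crossing_graph_diam]).  A connected graph with such a bound is
    quasi-isometric to the tree of the components of the complements of its
    balls ([quasi_tree_of_pieces]). *)

Set Implicit Arguments.
Unset Strict Implicit.
Unset Printing Implicit Defensive.

Local Open Scope classical_set_scope.
Local Open Scope card_scope.

Local Notation parallel := (clos_refl_sym_trans _ (@parallel_step _)).

(** * Squares and cubes of a cube complex *)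

Lemma cmap_ext m n (f g : cmap m n) :
  (forall x i, sval f x i = sval g x i) -> f = g.
Proof.
move=> fg; apply: val_inj; apply/ffunP => x; apply/ffunP => i; exact: fg.
Qed.

Definition upd n (x : cvertex n) (i : 'I_n) (b : bool) : cvertex n :=
  [ffun j => if j == i then b else x j].

Lemma plane_isometric n (i j : 'I_n) (ij : i != j) (x : cvertex n) :
  isometric [ffun t : cvertex 2 => upd (upd x j (t ord_max)) i (t ord0)].
Proof.
apply/forallP => s; apply/forallP => t; rewrite !ffunE /hamming.
pose h (k : 'I_2) := if k == ord0 then i else j.
have h_inj : injective h.
  move=> k l; rewrite /h; case: eqP => [->|/eqP k0]; case: eqP => [->|/eqP l0] //.
  - by move=> E; move: ij; rewrite E eqxx.
  - by move=> E; move: ij; rewrite E eqxx.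
  - by move=> _; apply: val_inj; case: k k0 => [[|[]]] //; case: l l0 => [[|[]]].
rewrite -(card_imset _ h_inj); apply/eqP/eq_card => k.
rewrite !inE !ffunE; apply/idP/imsetP.
  case: (eqVneq k i) => [-> st|ki]; first by exists ord0; rewrite ?inE.
  case: (eqVneq k j) => [-> st|kj]; last by rewrite eqxx.
  by exists ord_max; rewrite ?inE.
case=> l; rewrite inE => st ->; rewrite /h.
case: (eqVneq l ord0) st => [->|l0]; first by rewrite eqxx.
have -> : l = ord_max by apply: val_inj; case: l l0 => [[|[]]].
by rewrite [j == i]eq_sym (negbTE ij) eqxx.
Qed.

(** The 2-face through x in the directions i and j; its first coordinate runs along
    i. Taking x in the square itself and (i, j) = (1, 0) transposes the square. *)
Definition plane n (i j : 'I_n) (ij : i != j) (x : cvertex n) : cmap 2 n :=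
  Cmap (plane_isometric ij x).

Lemma cflip0_isometric :
  isometric [ffun t : cvertex 2 => upd t ord0 (~~ t ord0)].
Proof.
apply/forallP => s; apply/forallP => t; rewrite !ffunE /hamming.
apply/eqP; apply: eq_card => j; rewrite !inE !ffunE.
by case: (eqVneq j ord0) => [->|_]; rewrite ?(inj_eq negb_inj).
Qed.

Definition cflip0 : cmap 2 2 := Cmap cflip0_isometric.

Section Squares.
Variable X : cubeComplex.
Implicit Types a b c d e f : edge X.

(** The two edge paths a b and c d from the corner (0,0) to the corner (1,1) of
    a square: a and d are opposite sides, and so are b and c. *)
Definition sq a b c d := exists q : cube X 2,
  [/\ cedge q ord0 (czero 2) = a, cedge q ord_max (cone 2) = b,
      cedge q ord_max (czero 2) = c & cedge q ord0 (cone 2) = d].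

(** The chart of an edge in direction i forgets the i-th coordinate of its base
    vertex, so that one edge has two such descriptions. *)
Lemma cedge_ext n (c : cube X n) i (x y : cvertex n) :
  (forall j, j != i -> x j = y j) -> cedge c i x = cedge c i y.
Proof.
move=> xy; congr (face _ c); apply: cmap_ext => t j.
by rewrite !ffunE; case: eqP => // /eqP; exact: xy.
Qed.

Lemma erevK e : erev (erev e) = e.
Proof.
rewrite /erev -face_comp -[RHS]face_id; congr (face _ e).
by apply: cmap_ext => t j; rewrite !ffunE negbK.
Qed.

Lemma erev_inj e f : erev e = erev f -> e = f.
Proof. by move=> ef; rewrite -(erevK e) ef erevK. Qed.

Lemma src_erev e : src (erev e) = tgt e.
Proof.
rewrite /src /tgt /corner /erev -face_comp; congr (face _ e).
by apply: cmap_ext => t j; rewrite !ffunE.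
Qed.

Lemma tgt_erev e : tgt (erev e) = src e.
Proof. by rewrite -src_erev erevK. Qed.

Lemma src_cedge n (c : cube X n) i x : src (cedge c i x) = corner c (upd x i false).
Proof.
rewrite /src /corner /cedge -face_comp; congr (face _ c).
by apply: cmap_ext => t j; rewrite !ffunE.
Qed.

Lemma tgt_cedge n (c : cube X n) i x : tgt (cedge c i x) = corner c (upd x i true).
Proof.
rewrite /tgt /corner /cedge -face_comp; congr (face _ c).
by apply: cmap_ext => t j; rewrite !ffunE.
Qed.

Lemma cube_sq n (c : cube X n) i j (ij : i != j) x :
  sq (cedge c i (upd x j false)) (cedge c j (upd x i true))
     (cedge c j (upd x i false)) (cedge c i (upd x j true)).
Proof.
exists (face (plane ij x) c); split; rewrite /cedge -face_comp;
  congr (face _ c); apply: cmap_ext => t k; rewrite !ffunE;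
  by case: (eqVneq k i) => [E|_]; rewrite ?E ?(negbTE ij) ?eqxx /=; case: (k == j).
Qed.

Lemma I2_cases (i : 'I_2) : i = ord0 \/ i = ord_max.
Proof. by case: i => [[|[|//]]] h; [left|right]; apply: val_inj. Qed.

Lemma sq_sym a b c d : sq a b c d -> sq c d a b.
Proof.
case=> q [<- <- <- <-].
have := @cube_sq _ q ord_max ord0 isT (czero 2).
by congr sq; apply: cedge_ext => j; case: (I2_cases j) => ->; rewrite ?ffunE.
Qed.

(** The same square seen from the end of a. *)
Lemma sq_rot a b c d : sq a b c d -> sq (erev a) c b (erev d).
Proof.
case=> q [<- <- <- <-]; exists (face cflip0 q).
split; rewrite /cedge /erev -!face_comp; congr (face _ q); apply: cmap_ext => t k;
  by rewrite !ffunE; case: (I2_cases k) => ->; rewrite ?ffunE.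
Qed.

Lemma sq_ends a b c d : sq a b c d ->
  [/\ src a = src c, tgt a = src b, tgt c = src d & tgt b = tgt d].
Proof.
case=> q [<- <- <- <-]; rewrite !src_cedge !tgt_cedge.
by split; congr (corner q _); apply/ffunP => k; rewrite !ffunE;
   case: (I2_cases k) => ->.
Qed.

Lemma sq_link_adjacent a b c d : sq a b c d -> link_adjacent a c.
Proof. by case=> q [? ? ? ?]; exists q. Qed.

Lemma link_adjacent_sym e f : link_adjacent e f -> link_adjacent f e.
Proof.
case=> q [<- <-]; have s : sq (link_vertex q ord0) (cedge q ord_max (cone 2))
  (link_vertex q ord_max) (cedge q ord0 (cone 2)) by exists q.
exact: sq_link_adjacent (sq_sym s).
Qed.

Lemma cedge_square (q : cube X 2) i x y :
  cedge q i x = cedge q i y \/ exists b c, sq (cedge q i x) b c (cedge q i y).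
Proof.
have [j ij] : exists j : 'I_2, i != j.
  by case: (I2_cases i) => ->; [exists ord_max|exists ord0].
have E z : cedge q i z = cedge q i (upd z j (z j)).
  apply: cedge_ext => k _; rewrite !ffunE; by case: eqP => [->|].
have E' (b : bool) z z' : cedge q i (upd z j b) = cedge q i (upd z' j b).
  apply: cedge_ext => k ki; rewrite !ffunE.
  have -> : k = j by case: (I2_cases i) (I2_cases j) (I2_cases k) ij ki => -> [] -> [] ->.
  by rewrite eqxx.
rewrite (E x) (E y) (E' _ y x).
case: (x j) (y j) => [] []; try by left.
- right; have /sq_sym/sq_rot/sq_sym h := cube_sq q ij x.
  by eexists _, _; exact: h.
- by right; eexists _, _; exact: (cube_sq q ij x).
Qed.

Lemma parallel_cases e f : parallel_step e f ->
  f = erev e \/ f = e \/ exists b c, sq e b c f.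
Proof.
case=> [{}e|q i x y]; first by left.
by right; case: (cedge_square q i x y) => [->|[b [c h]]]; [left|right; exists b, c].
Qed.

Lemma sq_parallel a b c d : sq a b c d -> parallel_step a d.
Proof. by case=> q [<- _ _ <-]; constructor. Qed.

Section NPC.
Hypothesis npc : nonpositively_curved X.

(** Two squares with the same first sides a and c at their common corner have the
    same labelled vertices in the link, hence the same chart. *)
Lemma sq_uniq a b c d b' d' : sq a b c d -> sq a b' c d' -> b = b' /\ d = d'.
Proof.
case=> q [qa <- qc <-] [q' [qa' <- qc' <-]].
have [[_ inj] _] := npc (corner q (czero 2)).
have E z : corner z (czero 2) = src (cedge z ord0 (czero 2)) :> vertex X.
  rewrite src_cedge; congr corner; apply/ffunP => k.
  by rewrite !ffunE; case: eqP.
suff -> : q = q' by [].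
apply: inj => //; first by rewrite !E qa qa'.
by move=> i; case: (I2_cases i) => ->; rewrite /link_vertex ?qa ?qa' ?qc ?qc'.
Qed.

Lemma sq_neq a b c d : sq a b c d -> a <> c.
Proof.
case=> q [<- _ <- _] E.
have [[inj _] _] := npc (corner q (czero 2)).
by have := inj _ q erefl _ _ E.
Qed.

(** The flag condition gives a cube with edges a, b, c at its corner; by
    uniqueness its three faces at this corner are the given squares, and the
    conclusion lists the three faces at the opposite corner. *)
Lemma sq_cube a b c x1 y1 x2 y2 x3 y3 :
  sq a x1 c y1 -> sq b x2 c y2 -> sq a x3 b y3 ->
  exists a' b' c', [/\ sq x1 b' x3 c', sq x2 a' y3 c' & sq y1 b' y2 a'].
Proof.
move=> h1 h2 h3.
(* a is also the default of nth, which is never reached. *)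
pose e (i : 'I_3) := nth a [:: a; b; c] i.
have I3 (i : 'I_3) : [\/ i = ord0, i = lift ord0 ord0 | i = ord_max].
  by case: i => [[|[|[|//]]]] h; [constructor 1|constructor 2|constructor 3]; apply: val_inj.
have [_ flag] := npc (src a).
have ab := sq_neq h3; have bc := sq_neq h2; have ac := sq_neq h1.
have [|||k [kv ke]] := flag 3 e.
- have [s1 _ _ _] := sq_ends h1; have [s3 _ _ _] := sq_ends h3.
  by move=> i; case: (I3 i) => ->.
- by move=> i j; case: (I3 i) => ->; case: (I3 j) => -> //=; rewrite /e /= => /esym // E;
    case: ab; case: bc; case: ac.
- move=> i j; case: (I3 i) => ->; case: (I3 j) => -> //= _; rewrite /e /=;
  [exact: sq_link_adjacent h3|exact: sq_link_adjacent h1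
  |apply: link_adjacent_sym; exact: sq_link_adjacent h3
  |exact: sq_link_adjacent h2|apply: link_adjacent_sym; exact: sq_link_adjacent h1
  |apply: link_adjacent_sym; exact: sq_link_adjacent h2].
pose o0 : 'I_3 := ord0; pose o1 : 'I_3 := lift ord0 ord0; pose o2 : 'I_3 := ord_max.
have E i (x y : cvertex 3) : (forall j, j != i -> x j = y j) -> cedge k i x = cedge k i y.
  exact: cedge_ext.
have K i (x : cvertex 3) : (forall j, j != i -> x j = false) -> cedge k i x = e i.
  by move=> x0; rewrite -ke; apply: E => j /x0 ->; rewrite ffunE.
have ext i (x y : cvertex 3) : [&& (o0 != i) ==> (x o0 == y o0),
    (o1 != i) ==> (x o1 == y o1) & (o2 != i) ==> (x o2 == y o2)] ->
    forall j, j != i -> x j = y j.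
  by case/and3P=> h h' h'' j; case: (I3 j) => -> /[dup] ji;
     [move/(implyP h)|move/(implyP h')|move/(implyP h'')] => /eqP.
have [] := sq_uniq h3 (b' := cedge k o1 (upd (czero 3) o0 true))
                      (d' := cedge k o0 (upd (czero 3) o1 true)).
  have := @cube_sq _ k o0 o1 isT (czero 3).
  by congr sq; apply: K => j ji; rewrite !ffunE; case: ifP.
have [] := sq_uniq h2 (b' := cedge k o2 (upd (czero 3) o1 true))
                      (d' := cedge k o1 (upd (czero 3) o2 true)).
  have := @cube_sq _ k o1 o2 isT (czero 3).
  by congr sq; apply: K => j ji; rewrite !ffunE; case: ifP.
have [] := sq_uniq h1 (b' := cedge k o2 (upd (czero 3) o0 true))
                      (d' := cedge k o0 (upd (czero 3) o2 true)).
  have := @cube_sq _ k o0 o2 isT (czero 3).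
  by congr sq; apply: K => j ji; rewrite !ffunE; case: ifP.
move=> -> -> -> -> -> ->.
exists (cedge k o0 (cone 3)), (cedge k o1 (cone 3)), (cedge k o2 (cone 3)); split.
- have := @cube_sq _ k o2 o1 isT (cone 3).
  by congr sq; apply/E/ext; rewrite !ffunE.
- have := @cube_sq _ k o2 o0 isT (cone 3).
  by congr sq; apply/E/ext; rewrite !ffunE.
- have := @cube_sq _ k o0 o1 isT (cone 3).
  by congr sq; apply/E/ext; rewrite !ffunE.
Qed.

End NPC.

End Squares.

(** * Edge paths up to squares *)

Section Swaps.
Variable X : cubeComplex.
Hypothesis npc : nonpositively_curved X.
Implicit Types (a b c d e f g : edge X) (s t r p q : seq (edge X)).

(** Pushing an edge path across one square. *)
Inductive swap : seq (edge X) -> seq (edge X) -> Prop :=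
| swap_head a b c d t : sq a b c d -> swap [:: a, b & t] [:: c, d & t]
| swap_cons a s t : swap s t -> swap (a :: s) (a :: t).

Inductive swaps s : seq (edge X) -> Prop :=
| swaps_refl : swaps s s
| swaps_step t r : swaps s t -> swap t r -> swaps s r.

Lemma swap_sym s t : swap s t -> swap t s.
Proof.
by elim=> [a b c d r /sq_sym|a {}s {}t _]; [exact: swap_head|exact: swap_cons].
Qed.

Lemma swaps_trans s t r : swaps s t -> swaps t r -> swaps s r.
Proof. by move=> st; elim=> // u v _; exact: swaps_step. Qed.

Lemma swap_swaps s t : swap s t -> swaps s t.
Proof. exact: swaps_step (swaps_refl s). Qed.

Lemma swaps_sym s t : swaps s t -> swaps t s.
Proof.
elim=> [|u v _ us /swap_sym uv]; first exact: swaps_refl.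
exact: swaps_trans (swap_swaps uv) us.
Qed.

Lemma swaps_cons a s t : swaps s t -> swaps (a :: s) (a :: t).
Proof.
elim=> [|u v _ us uv]; first exact: swaps_refl.
by apply: swaps_step us _; exact: swap_cons.
Qed.

Lemma swaps_head a b c d t : sq a b c d -> swaps [:: a, b & t] [:: c, d & t].
Proof. by move=> h; apply/swap_swaps/swap_head. Qed.

Lemma swaps_catl u s t : swaps s t -> swaps (u ++ s) (u ++ t).
Proof. by move=> st; elim: u => //= a u; exact: swaps_cons. Qed.

Lemma swaps_catr u s t : swaps s t -> swaps (s ++ u) (t ++ u).
Proof.
elim=> [|v w _ us vw]; first exact: swaps_refl.
apply: swaps_step us _; elim: vw => [*|*]; [exact: swap_head|exact: swap_cons].
Qed.

Lemma swap_size s t : swap s t -> size s = size t.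
Proof. by elim=> //= a {}s {}t _ ->. Qed.

Lemma swaps_size s t : swaps s t -> size s = size t.
Proof. by elim=> // u v _ -> /swap_size. Qed.

Lemma swaps_nil s : swaps s [::] -> s = [::].
Proof. by move/swaps_size => /= /size0nil. Qed.

(** The divisibility lemma for paths up to squares. Along a chain of swaps, the
    first edge changes by squares at a fixed vertex; two successive changes, from
    a to b0 and from b0 to c, are merged into one. Both squares have b0 as a side,
    and the induction hypothesis compares their sides at the end of b0: either the
    squares coincide and a = c, or these sides span a third square, and the cube
    on the three squares contains a square with sides a and c. *)
Lemma exchange a b p q : swaps (a :: p) (b :: q) ->
  (a = b /\ swaps p q) \/
  exists b' a' r, [/\ sq a b' b a', swaps p (b' :: r) & swaps q (a' :: r)].
Proof.
move: {2}(size p) (erefl (size p)) => n.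
elim: n a b p q => [|n IH] a b p q pn H.
  have := swaps_size H; rewrite /= pn; case: q H => // H _.
  have ? := size0nil pn; subst p.
  left; suff : forall s t, swaps s t -> s = [:: a] -> t = [:: a].
    by move=> /(_ _ _ H erefl)[->]; split=> //; exact: swaps_refl.
  move=> s t; elim=> // u v _ E uv /E ?; subst u.
  by inversion_clear uv; match goal with h : swap [::] _ |- _ => inversion h end.
suff K : forall s t, swaps s t -> s = a :: p -> forall b q, t = b :: q ->
    (a = b /\ swaps p q) \/
    exists b' a' r, [/\ sq a b' b a', swaps p (b' :: r) & swaps q (a' :: r)].
  exact: K H erefl _ _ erefl.
move=> {b q H} s t; elim=> [|{}t r st K tr] sE b q tE; subst s.
  by move: tE => [-> ->]; left; split=> //; exact: swaps_refl.
case: tr tE st K => [b0 b1 c d {}r h|b0 {}t {}r tr] [<- <-] st /(_ erefl _ _ erefl).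
  case=> [[ab pE]|[b' [a' [u [h' pE uE]]]]].
    subst b0; right; exists b1, d, r; split=> //; exact: swaps_refl.
  have szr : size (b1 :: r) = n.+1 by have := swaps_size st; rewrite /= pn => -[->].
  (* Both squares are seen from the end of b0. *)
  have h'' := sq_rot (sq_sym h').
  have [|[b1a ur]|[x [y [v [h3 rE vE]]]]] := IH _ _ _ _ _ uE.
  - by case: szr.
  - subst b1; have [ac /erev_inj bd] := sq_uniq npc h'' (sq_rot h).
    subst a b'; left; split=> //; apply: swaps_trans pE _.
    exact/swaps_cons/swaps_sym.
  - have [A [B [C [hB hA hBA]]]] := sq_cube npc (sq_sym h'') (sq_sym (sq_rot h)) (sq_sym h3).
    right; exists B, A, (erev C :: v); split=> //.
      apply: swaps_trans pE _; apply: swaps_trans (swaps_cons _ vE) _.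
      by apply: swaps_head; move/sq_rot: hB; rewrite erevK.
    apply: swaps_trans (swaps_cons _ rE) _.
    by apply: swaps_head; move/sq_rot: hA; rewrite erevK.
case=> [[-> pt]|[b' [a' [u [h pE tE]]]]].
  by left; split=> //; apply: swaps_step pt tr.
right; exists b', a', u; split=> //.
exact: swaps_trans (swaps_sym (swap_swaps tr)) tE.
Qed.

Lemma swaps_cons_inj a s t : swaps (a :: s) (a :: t) -> swaps s t.
Proof.
by case/exchange => [[]//|[b [c [r [h _ _]]]]]; case: (sq_neq npc h).
Qed.

(** A property of the word itself; [reduced] tests it on all the equivalent paths. *)
Inductive backtracks : seq (edge X) -> Prop :=
| backtracks_head e s : backtracks [:: e, erev e & s]
| backtracks_cons e s : backtracks s -> backtracks (e :: s).

Definition reduced s := forall t, swaps s t -> ~ backtracks t.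

Lemma reduced_swaps s t : swaps s t -> reduced s -> reduced t.
Proof. by move=> st sr u tu; apply: sr; exact: swaps_trans st tu. Qed.

Lemma reduced_catr s t : reduced (s ++ t) -> reduced t.
Proof.
move=> st u tu bu; apply: (st (s ++ u)); first exact: swaps_catl.
by elim: s {st} => //= a s; exact: backtracks_cons.
Qed.

Lemma reduced_catl s t : reduced (s ++ t) -> reduced s.
Proof.
move=> st u su bu; apply: (st (u ++ t)); first exact: swaps_catr.
by elim: bu => [e v|e v _ bv] /=; [exact: backtracks_head|exact: backtracks_cons].
Qed.

Lemma reduced_behead a s : reduced (a :: s) -> reduced s.
Proof. exact: (@reduced_catr [:: a]). Qed.

Lemma reduced_nil : reduced [::].
Proof. by move=> t /swaps_sym/swaps_nil -> h; inversion h. Qed.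

(** A backtrack created by adding e in front of a reduced path involves this e,
    up to squares. The backtrack found after swaps is compared with the first
    edges by [exchange]; if it lies deeper in the path, remove the first edge and
    use induction. *)
Lemma nonreduced_cons e r : reduced r -> ~ reduced (e :: r) ->
  exists y, swaps r (erev e :: y).
Proof.
move: {2}(size r) (erefl (size r)) => n.
elim: n e r => [|n IH] e r rn rr /existsNP[t /not_implyP[H /contrapT bt]].
  have := size0nil rn => ?; subst r.
  have /= := swaps_size H; inversion bt; subst => //.
  by case: s H bt H0 => // _ _ h; inversion h.
case: bt H => [f t' H|f t' bt' H].
  have [[-> E]|[f' [e' [z [h E1 E2]]]]] := exchange H; first by exists t'.
  have [[E _]|[e'' [f'' [y [h' E3 E4]]]]] := exchange E2.
    subst e'; by case: (sq_neq npc (sq_rot (sq_sym h))).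
  have [E5 E6] := sq_uniq npc h' (sq_rot (sq_sym h)); subst e'' f''.
  case: (rr [:: f', erev f' & y]); last exact: backtracks_head.
  by apply: swaps_trans E1 _; exact: swaps_cons.
have [[-> E]|[f' [e' [z [h E1 E2]]]]] := exchange H; first by case: (rr _ E).
have zr : reduced z by apply: (@reduced_behead f'); apply: reduced_swaps rr.
have [||y zy] := IH e' z _ zr.
- by have := swaps_size E1; rewrite rn => -[].
- by move=> /(_ _ (swaps_sym E2)).
exists (f :: y); apply: swaps_trans E1 _; apply: swaps_trans (swaps_cons _ zy) _.
by apply/swaps_head/sq_sym; exact: sq_rot h.
Qed.

(** Adding e in front of r and cancelling if possible. The formulation is symmetric
    under e <-> erev e, r <-> r', so that backtracks act trivially. *)
Definition act e r r' :=
  [/\ reduced r, reduced r' & swaps r (erev e :: r') \/ swaps r' (e :: r)].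

Lemma act_sym e r r' : act e r r' -> act (erev e) r' r.
Proof. by case=> ? ? [?|?]; split=> //; [right|left; rewrite erevK]. Qed.

Lemma act_total e r : reduced r -> exists r', act e r r'.
Proof.
move=> rr; have [er|/(nonreduced_cons rr)[y ry]] := pselect (reduced (e :: r)).
  by exists (e :: r); split=> //; right; exact: swaps_refl.
exists y; split=> //; last by left.
by apply: (@reduced_behead (erev e)); apply: reduced_swaps rr.
Qed.

Lemma act_uniq e r s r' s' : swaps r s -> act e r r' -> act e s s' -> swaps r' s'.
Proof.
have K u v u' v' : swaps u v -> act e u u' -> act e v v' ->
    swaps u (erev e :: u') -> swaps v' (e :: v) -> False.
  move=> uv [_ _ _] [_ v'r _] uu' vv'.
  apply: (v'r [:: e, erev e & u']); last exact: backtracks_head.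
  by apply: swaps_trans vv' _; apply/swaps_cons/(swaps_trans (swaps_sym uv)).
move=> rs A B; have [_ _ [H|H]] := A; have [_ _ [H'|H']] := B.
- apply: (@swaps_cons_inj (erev e)); apply: swaps_trans (swaps_sym H) _.
  exact: swaps_trans rs H'.
- by case: (K _ _ _ _ rs A B H H').
- by case: (K _ _ _ _ (swaps_sym rs) B A H' H).
- apply: swaps_trans H _; apply: swaps_trans (swaps_sym H').
  exact: swaps_cons.
Qed.

Lemma act_swaps e r r' s' : act e r r' -> swaps r' s' -> act e r s'.
Proof.
case=> rr r'r H rs'; split=> //; first exact: reduced_swaps r'r.
case: H => H; [left|right].
  by apply: swaps_trans H _; exact: swaps_cons.
exact: swaps_trans (swaps_sym rs') H.
Qed.

(** If b extends r and a cancels, then erev a is exchanged with b through the given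
    square, so that r starts with erev d: thus d cancels, and c extends. *)
Lemma act_square_ext a b c d r r1 r2 : sq a b c d ->
  swaps r1 (b :: r) -> act b r r1 -> act a r1 r2 ->
  exists2 r1', act d r r1' & act c r1' r2.
Proof.
move=> h E [rr r1r _] [_ r2r [E2|E2]].
  have E3 := swaps_trans (swaps_sym E) E2.
  have h' := sq_sym (sq_rot h).
  have [[ba _]|[x [y [z [h'' rx ry]]]]] := exchange E3.
    by case: (sq_neq npc h').
  have [? ?] := sq_uniq npc h'' h'; subst x y.
  have zr : reduced z by apply: (@reduced_behead c); exact: reduced_swaps r2r.
  by exists z; split=> //; [left|right].
have E3 : swaps r2 [:: c, d & r].
  apply: swaps_trans E2 _; apply: swaps_trans (swaps_cons _ E) _.
  exact: swaps_head.
have cdr := reduced_swaps E3 r2r; have dr := reduced_behead cdr.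
by exists (d :: r); split=> //; right=> //; exact: swaps_refl.
Qed.

(** The two boundary paths of a square act in the same way. If b or d extends r
    this is [act_square_ext], for the square or its transpose; otherwise both
    are cancelled, r starts with both erev b and erev d, and these can be
    exchanged through the same square. *)
Lemma act_square a b c d r r1 r2 : sq a b c d -> act b r r1 -> act a r1 r2 ->
  exists2 r1', act d r r1' & act c r1' r2.
Proof.
move=> h B A; have [rr r1r [E|E]] := B; last exact: act_square_ext B A.
have [r1' D] := act_total d rr; have [_ r1'r [E'|E']] := D; last first.
  have [r2' C] := act_total c r1'r.
  have [r1'' B' A'] := act_square_ext (sq_sym h) E' D C.
  have E2 := act_uniq (act_uniq (swaps_refl r) B' B) A' A.
  by exists r1' => //; apply: act_swaps C E2.
have h' := sq_rot (sq_sym (sq_rot h)).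
have [[bd _]|[x [y [z [h'' rx ry]]]]] := exchange (swaps_trans (swaps_sym E) E').
  by case: (sq_neq npc h').
have [? ?] := sq_uniq npc h'' h'; subst x y.
have zr : reduced z by apply: (@reduced_behead (erev a)); exact: reduced_swaps r1r.
have Az : act a r1 z by split=> //; left.
exists r1' => //; apply: (@act_swaps _ _ z); first by split=> //; left.
exact: act_uniq (swaps_refl _) Az A.
Qed.

(** A normal form of s, that is a reduced path homotopic to s; it is only unique
    up to [swaps]. *)
Fixpoint nf s r : Prop :=
  if s is e :: s' then exists2 r', nf s' r' & act e r' r else r = [::].

Lemma nf_reduced s r : nf s r -> reduced r.
Proof. by case: s => [->|e s [r' _ []//]]; exact: reduced_nil. Qed.

Lemma nf_total s : exists r, nf s r.
Proof.
elim: s => [|e s [r sr]]; first by exists [::].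
by have [r' H] := act_total e (nf_reduced sr); exists r', r.
Qed.

Lemma nf_swaps s r r' : swaps r r' -> nf s r -> nf s r'.
Proof.
case: s => [|e s] rr' /=; first by move=> E; subst r; exact/swaps_nil/swaps_sym.
by case=> u su ur; exists u => //; exact: act_swaps rr'.
Qed.

Lemma nf_uniq s r r' : nf s r -> nf s r' -> swaps r r'.
Proof.
elim: s r r' => [|e s IH] r r' /=; first by move=> -> ->; exact: swaps_refl.
by case=> u su ur [v sv vr']; apply: act_uniq ur vr'; exact: IH.
Qed.

Lemma nf_id s : reduced s -> nf s s.
Proof.
elim: s => // e s IH er; have sr := reduced_behead er.
by exists s; [exact: IH|split=> //; right; exact: swaps_refl].
Qed.

Lemma nf_catl u s t : (forall r, nf s r -> nf t r) -> forall r, nf (u ++ s) r -> nf (u ++ t) r.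
Proof.
by move=> st; elim: u => //= e u IH r [r' /IH ur' r'r]; exists r'.
Qed.

Lemma nf_backtrack s t e r : nf (s ++ [:: e, erev e & t]) r <-> nf (s ++ t) r.
Proof.
have K r1 : nf [:: e, erev e & t] r1 -> nf t r1.
  case=> r2 [r3 tr3 A] B; apply: nf_swaps tr3; apply: act_uniq (swaps_refl r2) _ B.
  by have := act_sym A; rewrite erevK.
split; apply: nf_catl => r1; first exact: K.
move=> tr1; have [r2 H] := nf_total [:: e, erev e & t].
apply: nf_swaps (H); exact: nf_uniq (K _ H) tr1.
Qed.

Lemma nf_square a b c d s t r : sq a b c d ->
  nf (s ++ [:: a, b & t]) r -> nf (s ++ [:: c, d & t]) r.
Proof.
move=> h; apply: nf_catl => r2 [r1 [r0 tr0 B] A].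
by have [r1' D C] := act_square h B A; exists r1' => //; exists r0.
Qed.

(** The suffix u makes the statement stable under the contexts of
    [htpy_step]. *)
Lemma nf_homotopic v w s t u r : homotopic v w s t -> nf (s ++ u) r <-> nf (t ++ u) r.
Proof.
elim=> {s t} [s t [_ _]|s|s t _ [? ?]|s t t' _ [? ?] _ [? ?]]; try by split; auto.
case=> {}s {}t => [e|q].
  rewrite -!catA /=; exact: nf_backtrack.
have h : sq (cedge q ord0 (czero 2)) (cedge q ord_max (cone 2))
            (cedge q ord_max (czero 2)) (cedge q ord0 (cone 2)) by exists q.
by rewrite -!catA; split; [exact: nf_square|apply: nf_square; exact: sq_sym].
Qed.

End Swaps.

(** * Geodesics of a CAT(0) cube complex *)

Section Geodesics.
Variable X : cubeComplex.
Hypothesis X_CAT0 : CAT0 X.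
Implicit Types (a b c d e f g : edge X) (s t r : seq (edge X)) (u v w x y : vertex X).

Let npc : nonpositively_curved X := proj2 X_CAT0.

Lemma edge_path_cat v s t w :
  edge_path v (s ++ t) w <-> exists2 u, edge_path v s u & edge_path u t w.
Proof.
elim: s v => [|e s IH] v /=; first by split=> [|[u ->]//]; exists v.
split=> [[ev /IH[u su ut]]|[u [ev su] ut]]; first by exists u.
by split=> //; apply/IH; exists u.
Qed.

Lemma edge_path_swaps s t : swaps s t ->
  forall v w, edge_path v s w -> edge_path v t w.
Proof.
elim=> // {}t r _ IH tr v w /IH {IH}.
elim: tr v => [a b c d {}t /sq_ends[ac ab cd bd]|a {}t {}r _ IH] v /=.
  by rewrite -ac -cd bd => -[-> [_ ?]].
by case=> -> /IH.
Qed.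

Definition inv_path s := rev (map (@erev X) s).

Lemma edge_path_inv v s w : edge_path v s w -> edge_path w (inv_path s) v.
Proof.
elim: s v => [|e s IH] v /=; first by move->.
case=> <- /IH; rewrite /inv_path /= rev_cons -cats1 => ?.
by apply/edge_path_cat; exists (tgt e) => //=; rewrite src_erev tgt_erev.
Qed.

Lemma size_inv s : size (inv_path s) = size s.
Proof. by rewrite size_rev size_map. Qed.

Lemma edge_path_ex v w : exists s, edge_path v s w.
Proof.
have [[conn _] _] := X_CAT0; have [n [p [<- <- pw _]]] := conn v w I I.
elim: n pw => [|n IH] pw; first by exists [::].
have [|s ps] := IH; first by move=> i ?; apply: pw; exact: ltnW.
have [e [en en1]] := pw n (ltnSn n).
by exists (s ++ [:: e]); apply/edge_path_cat; exists (p n).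
Qed.

Lemma edge_path_nf s r : nf s r -> forall v w, edge_path v s w -> edge_path v r w.
Proof.
elim: s r => [|e s IH] r /=; first by move=> ->.
case=> r' /IH r'P [_ _ [H|H]] v w [<- /r'P].
  by move/(edge_path_swaps H) => /= []; rewrite tgt_erev.
by move=> ?; apply: (edge_path_swaps (swaps_sym H)).
Qed.

Lemma nf_size s r : nf s r -> (size r <= size s)%N /\ odd (size r) = odd (size s).
Proof.
elim: s r => [|e s IH] r /=; first by move->.
by case=> r' /IH[? ?] [_ _ [/swaps_size H|/swaps_size H]]; move: H => /=; lia.
Qed.

(** The path s followed by the inverse of t is homotopic to a point, so that s has
    the same normal forms as t. *)
Lemma reduced_paths_swaps v w s t :
  edge_path v s w -> edge_path v t w -> reduced s -> reduced t -> swaps s t.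
Proof.
move=> sp tp sr tr; have [[_ sc] _] := X_CAT0.
have h : homotopic v v (s ++ inv_path t) [::].
  by apply: sc; apply/edge_path_cat; exists w => //; exact: edge_path_inv.
have K r : nf (s ++ inv_path t ++ t) r <-> nf s r.
  elim: (t) => [|e t' IH]; first by rewrite /inv_path /= cats0.
  rewrite /inv_path /= rev_cons cat_rcons -IH !catA -{2}(erevK e).
  exact: nf_backtrack.
apply: nf_uniq (nf_id sr) _ => //; apply/K.
by rewrite catA; apply/(nf_homotopic npc _ _ h); exact: nf_id.
Qed.

(** The distance in the 1-skeleton: by [dist_path] and [dist_reduced], reduced
    paths are shortest. *)
Definition dist v w : nat :=
  xget 0%N [set n | exists s, [/\ edge_path v s w, reduced s & size s = n]].

Lemma geodesic v w :
  exists s, [/\ edge_path v s w, reduced s & size s = dist v w].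
Proof.
rewrite /dist; case: xgetP => [n -> //|H].
have [s sp] := edge_path_ex v w; have [r sr] := nf_total npc s.
case: (H (size r)); exists r; split=> //; last exact: nf_reduced sr.
exact: edge_path_nf sr _ _ sp.
Qed.

Lemma dist_reduced v w s : edge_path v s w -> reduced s -> size s = dist v w.
Proof.
have [t [tp tr <-]] := geodesic v w.
by move=> sp sr; exact/swaps_size/(reduced_paths_swaps sp tp sr tr).
Qed.

(** The parity clause says that the 1-skeleton is bipartite. *)
Lemma dist_path v w s : edge_path v s w ->
  (dist v w <= size s)%N /\ odd (dist v w) = odd (size s).
Proof.
move=> sp; have [r sr] := nf_total npc s.
rewrite -(dist_reduced (edge_path_nf sr sp) (nf_reduced sr)).
exact: nf_size.
Qed.

Lemma reduced_dist v w s : edge_path v s w -> size s = dist v w -> reduced s.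
Proof.
move=> sp sd t st bt.
have [t' t'p t't] : exists2 t', edge_path v t' w & (size t').+2 = size t.
  have := edge_path_swaps st sp; elim: bt v {st sp sd} => [e r|e r _ IH] v /=.
    by rewrite src_erev tgt_erev => -[<- [_ rp]]; exists r.
  by case=> ev /IH[t' t'p <-]; exists (e :: t').
have [] := dist_path t'p; have := swaps_size st; lia.
Qed.

Lemma dist_sym v w : dist v w = dist w v.
Proof.
have K x y : (dist x y <= dist y x)%N.
  have [s [sp _ <-]] := geodesic y x.
  by have [] := dist_path (edge_path_inv sp); rewrite size_inv.
by apply/eqP; rewrite eqn_leq !K.
Qed.

Lemma dist_refl v : dist v v = 0%N.
Proof. by have [] := @dist_path v v [::] erefl; case: (dist v v). Qed.

Lemma dist_eq0 v w : dist v w = 0%N -> v = w.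
Proof. by have [[|e s] [sp _ <-]] := geodesic v w. Qed.

Lemma dist_edge e w :
  dist (src e) w = (dist (tgt e) w).+1 \/ dist (tgt e) w = (dist (src e) w).+1.
Proof.
have [s [sp _ sd]] := geodesic (tgt e) w.
have [t [tp _ td]] := geodesic (src e) w.
have [] := @dist_path (src e) w (e :: s) (conj erefl sp).
have [] := @dist_path (tgt e) w (erev e :: t) _.
  by rewrite /= src_erev tgt_erev.
by rewrite /= sd td; lia.
Qed.

Lemma no_loop e : src e <> tgt e.
Proof. by have := dist_edge e (src e) => /[swap] <-; lia. Qed.

Lemma dist_src_tgt e : dist (src e) (tgt e) = 1%N.
Proof.
by have := dist_edge e (tgt e); rewrite dist_refl; lia.
Qed.

(** Two edges with the same ends are two geodesics, and no square can be used in
    a path of length one. *)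
Lemma edge_inj e f : src e = src f -> tgt e = tgt f -> e = f.
Proof.
move=> se te.
have re (g : edge X) : reduced [:: g].
  by apply: (@reduced_dist (src g) (tgt g)) => //; rewrite dist_src_tgt.
have : swaps [:: e] [:: f].
  by apply: (@reduced_paths_swaps (src e) (tgt e)) => //=; rewrite ?se ?te.
by case/(exchange npc) => [[]//|[b [c [r [_ /swaps_size]]]]].
Qed.

Lemma descending v w : v <> w ->
  exists2 e, src e = v & dist v w = (dist (tgt e) w).+1.
Proof.
move=> vw; have [[|e s] [sp sr sd]] := geodesic v w; first by case: vw.
case: sp => ev sp; exists e => //; rewrite -sd /=.
by rewrite (dist_reduced sp (reduced_behead sr)).
Qed.

(** Geodesics from e and f to w have the same ends, hence are equivalent, and
    [exchange] gives the square. *)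
Lemma quadrangle e f w : src e = src f -> e <> f ->
  (dist (tgt e) w < dist (src e) w)%N -> (dist (tgt f) w < dist (src f) w)%N ->
  exists f' e', sq e f' f e' /\ dist (src e) w = (dist (tgt f') w).+2.
Proof.
move=> ef nef de df.
have K g : (dist (tgt g) w < dist (src g) w)%N ->
    exists s, [/\ edge_path (src g) (g :: s) w, reduced (g :: s) & size (g :: s) = dist (src g) w].
  move=> dg; have [s [sp _ sd]] := geodesic (tgt g) w.
  have gp : edge_path (src g) (g :: s) w by [].
  have E : size (g :: s) = dist (src g) w.
    by rewrite /= sd; have := dist_edge g w; lia.
  by exists s; split=> //; exact: reduced_dist gp E.
have [s [sp sr ss]] := K e de; have [t [tp tr ts]] := K f df.
rewrite -ef in tp.
have [[//]|[f' [e' [r [h sE tE]]]]] := exchange npc (reduced_paths_swaps sp tp sr tr).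
exists f', e'; split=> //; rewrite -ss /= (swaps_size sE) /=.
congr _.+2; have := edge_path_swaps (swaps_cons e sE) sp => -[_ [_ rp]].
apply: (dist_reduced rp).
by have := reduced_swaps (swaps_cons e sE) sr => /reduced_behead/reduced_behead.
Qed.

(** * The two sides of a hyperplane *)

Definition closer w e := (dist (src e) w < dist (tgt e) w)%N.

Lemma closer_erev w e : closer w (erev e) = ~~ closer w e.
Proof. by rewrite /closer src_erev tgt_erev; have := dist_edge e w; lia. Qed.

(** If a and d disagreed then, up to rotation, the end of a would be farther from w
    than its two neighbors in the square. By the quadrangle condition the fourth
    vertex would be closer than them, whereas it is farther. *)
Lemma closer_sq w a b c d : sq a b c d -> closer w a = closer w d.
Proof.
have K (a' b' c' d' : edge X) : sq a' b' c' d' ->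
    closer w a' -> closer w d' = false -> False.
  move=> h; have [s1 s2 s3 s4] := sq_ends h; rewrite /closer => wa wd.
  have h' := sq_rot h.
  have [|||f [e [h'' E]]] := @quadrangle (erev a') b' w _ (sq_neq npc h').
  - by rewrite src_erev.
  - by rewrite src_erev tgt_erev.
  - by have := dist_edge b' w; have := dist_edge c' w;
       have := dist_edge d' w; rewrite -s1 -s2 s3 s4; lia.
  have [? _] := sq_uniq npc h'' h'; subst f.
  move: E; rewrite src_erev s3; have := dist_edge b' w; rewrite s4 -s2.
  by have := dist_edge c' w; rewrite -s1 s3; lia.
move=> h; have K1 := K _ _ _ _ h; have := K _ _ _ _ (sq_rot h).
rewrite !closer_erev => K2; case: (closer w a) K1 K2 => K1 K2.
  by case: (closer w d) K1 K2 => // /(_ isT erefl).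
by case: (closer w d) K1 K2 => // _ /(_ isT erefl).
Qed.

(** The boolean o tells whether the orientations disagree. *)
Lemma closer_parallel e f : parallel e f ->
  exists o : bool, forall w, closer w f = o (+) closer w e.
Proof.
elim=> {e f} [e f /parallel_cases[->|[->|[b [c h]]]]|e|e f _ [o E]|e f g _ [o E] _ [o' E']].
- by exists true => w; rewrite closer_erev.
- by exists false.
- by exists false => w; rewrite (closer_sq w h).
- by exists false.
- by exists o => w; rewrite E addbA addbb.
- by exists (o' (+) o) => w; rewrite E' E addbA.
Qed.

Lemma parallel_erev e f : parallel (erev e) f -> parallel e f.
Proof. by apply: rst_trans; apply: rst_step; constructor. Qed.

(** Let g change sides. A geodesic from the start of g to the start of e begins with
    an edge spanning a square with g, whose opposite side also changes sides and is
    nearer to e: the induction ends with g = e. *)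
Lemma parallel_of_closer_neq e g : closer (src g) e != closer (tgt g) e -> parallel g e.
Proof.
(* Up to reversing g, the start of g is on the side of the start of e. *)
wlog H : g / closer (src g) e.
  move=> K; case E : (closer (src g) e) => E'; first by apply: K; rewrite ?E.
  apply: parallel_erev; apply: K; rewrite ?src_erev ?tgt_erev ?E.
    by case: (closer (tgt g) e) E'.
  by rewrite eq_sym.
rewrite H; case H': (closer _ e) => // _; move: H H'.
move: {2}(dist _ _) (erefl (dist (src e) (src g))) => k.
elim: k g => [|k IH] g; rewrite /closer.
  have := dist_edge g (src e); have := dist_edge g (tgt e).
  have := dist_edge e (src g); have := dist_edge e (tgt g).
  rewrite !(dist_sym (src g)) !(dist_sym (tgt g)) => *.
  have /dist_eq0 ? : dist (src e) (src g) = 0%N by lia.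
  have /dist_eq0 ? : dist (tgt e) (tgt g) = 0%N by lia.
  have -> : g = e by exact: edge_inj.
  exact: rst_refl.
move=> dk H1 H2.
have := dist_edge g (src e); have := dist_edge g (tgt e).
have := dist_edge e (src g); have := dist_edge e (tgt g).
rewrite !(dist_sym (src g)) !(dist_sym (tgt g)) => H3 H4 H5 H6.
have [|h hg dh] := @descending (src g) (src e).
  by move=> E; rewrite E dist_refl in dk.
rewrite !(dist_sym _ (src e)) in dh.
have H7 := dist_edge h (tgt e); have H8 := dist_edge e (tgt h).
rewrite hg !(dist_sym (src g)) !(dist_sym (tgt h)) in H7 H8.
have [||||h' [g' [s E]]] := @quadrangle g h (tgt e).
- by [].
- by move=> gh; subst h; lia.
- by rewrite !(dist_sym _ (tgt e)); lia.
- by rewrite !(dist_sym _ (tgt e)) hg; lia.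
have [_ E2 E3 E4] := sq_ends s.
have H9 := dist_edge h' (src e); have H10 := dist_edge e (tgt h').
rewrite !(dist_sym _ (tgt e)) in E; rewrite !(dist_sym (tgt h')) !(dist_sym (src h')) in H9 H10.
apply: rst_trans (rst_step _ _ _ _ (sq_parallel s)) _.
apply: IH; rewrite /closer -?E3 -?E4; try lia.
by rewrite -E2 in H9; lia.
Qed.

Lemma geodesic_separates v s1 g s2 w : edge_path v (s1 ++ g :: s2) w ->
  reduced (s1 ++ g :: s2) -> closer v g && ~~ closer w g.
Proof.
move=> /edge_path_cat[u s1p [gu s2p]] sr; subst u; rewrite /closer.
have r1 : reduced s1 by exact: reduced_catl sr.
have r1g : reduced (s1 ++ [:: g]) by apply: (@reduced_catl _ _ s2); rewrite -catA.
have s1gp : edge_path v (s1 ++ [:: g]) (tgt g).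
  by apply/edge_path_cat; exists (src g).
have gr := reduced_catr sr; have r2 := reduced_behead gr.
have := dist_reduced s1p r1; have := dist_reduced s1gp r1g.
have := dist_reduced s2p r2.
have := @dist_reduced (src g) w (g :: s2) (conj erefl s2p) gr.
by rewrite size_cat /= !(dist_sym v); lia.
Qed.

End Geodesics.

(** * Walks *)

Lemma set_inj_card_le (T U : Type) (f : T -> U) (A : set T) (B : set U) :
  (forall i j, A i -> A j -> f i = f j -> i = j) -> (forall i, A i -> B (f i)) ->
  A #<= B.
Proof.
move=> f_inj fAB; have {}f_inj : {in A &, injective f}.
  by move=> i j; rewrite !inE; exact: f_inj.
have /card_esym := inj_card_eq f_inj; rewrite card_eq_le => /andP[+ _].
by move/card_le_trans; apply; apply: subset_card_le => _ [i Ai <-]; exact: fAB.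
Qed.

Section WalkLemmas.
Variables (V : Type) (E : V -> V -> Prop).
Implicit Types (A B : set V) (x y z : V).

Lemma joined0 A x y : joined_in E A 0 x y <-> A x /\ x = y.
Proof.
split=> [[p [<- <- _ pA]]|[Ax <-]]; first by split=> //; exact: pA.
by exists (fun=> x).
Qed.

Lemma joinedS A n x y :
  joined_in E A n.+1 x y <-> exists z, [/\ A x, E x z & joined_in E A n z y].
Proof.
split=> [[p [<- <- pw pA]]|[z [Ax xz [p [p0 <- pw pA]]]]]; last subst z.
  exists (p 1); split; [exact: pA|exact: pw|].
  by exists (p \o S); split=> // i; [exact: (pw i.+1)|exact: (pA i.+1)].
exists (fun i => if i is j.+1 then p j else x); split=> //.
  by case=> // i; exact: (pw i).
by case=> // i; exact: (pA i).
Qed.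

Lemma joined_cat A n m x y z : joined_in E A n x y -> joined_in E A m y z ->
  joined_in E A (n + m) x z.
Proof.
elim: n x => [|n IH] x; first by move=> /joined0[_ ->].
by move=> /joinedS[u [Ax xu uy]] yz; apply/joinedS; exists u; split=> //; exact: IH.
Qed.

Lemma joined_ends A n x y : joined_in E A n x y -> A x /\ A y.
Proof. by case=> p [<- <- _ pA]; split; exact: pA. Qed.

Lemma joined_rcons A n x y z : joined_in E A n x y -> E y z -> A z ->
  joined_in E A n.+1 x z.
Proof.
move=> xy yz Az; have [_ Ay] := joined_ends xy.
rewrite -addn1; apply: joined_cat xy _.
by apply/joinedS; exists z; split=> //; exact/joined0.
Qed.

Lemma joined_sub A B n x y : A `<=` B -> joined_in E A n x y -> joined_in E B n x y.
Proof. by move=> AB [p [p0 pn pw pA]]; exists p; split=> // i /pA/AB. Qed.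

Lemma joined_sym A n x y : (forall u v, E u v -> E v u) ->
  joined_in E A n x y -> joined_in E A n y x.
Proof.
move=> Es; elim: n x => [|n IH] x; first by move=> /joined0[? ?]; subst y; exact/joined0.
by move=> /joinedS[z [Ax /Es zx /IH yz]]; exact: joined_rcons yz zx Ax.
Qed.

(** A shortest walk visits distinct vertices of A. *)
Lemma joined_short A N n x y : A #<= `I_N -> joined_in E A n x y ->
  exists2 m, (m < N)%N & joined_in E A m x y.
Proof.
move=> AN xy; have ex : exists m, `[< joined_in E A m x y >] by exists n; apply/asboolP.
have [m /asboolP[p [p0 pm pw pA]] m_min] := ex_minnP ex.
exists m; last by exists p.
have p_inj i j : (i < j)%N -> (j <= m)%N -> p i <> p j.
  move=> ij jm pij.
  have K k l : (k + l <= m)%N -> joined_in E A l (p k) (p (k + l)).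
    move=> klm; exists (fun r => p (k + r)); split; rewrite ?addn0 // => r rl.
      by rewrite addnS; apply: pw; lia.
    by apply: pA; lia.
  suff /asboolP/m_min : joined_in E A (i + (m - j)) x y by lia.
  apply: (@joined_cat _ _ _ _ (p i)).
    by rewrite -p0; apply: (K 0%N); lia.
  by rewrite pij -pm -{2}(subnKC jm); apply: K; lia.
rewrite -card_le_II; apply: card_le_trans AN.
apply: (set_inj_card_le (f := p)) => [i j|i]; rewrite /= !ltnS; last exact: pA.
move=> im jm pij; case: (ltngtP i j) => // ij.
  by case: (p_inj _ _ ij jm).
by case: (p_inj _ _ ij im).
Qed.

End WalkLemmas.

(** * Links of vertices *)

Section Links.
Variable X : cubeComplex.
Hypothesis X_CAT0 : CAT0 X.

(** Let P w say that all the edges at v which are closer to w lie in the component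
    of e in the link. These edges are pairwise adjacent, and they increase with the
    distance to w; so P is preserved along edges avoiding v. It holds at the end of
    e, hence at the end of f, where it concerns f only. *)
Lemma link_connected (v : vertex X) : ~ cut_vertex v ->
  forall e f : edge X, src e = v -> src f = v ->
  exists n, joined_in (@link_adjacent X) [set g | src g = v] n e f.
Proof.
move=> /contrapT conn e f ev fv.
pose linked g := exists n, joined_in (@link_adjacent X) [set g | src g = v] n e g.
pose P w := forall g, src g = v -> (dist (tgt g) w < dist v w)%N -> linked g.
have step w w' : w <> v -> w' <> v -> neighbor w w' -> P w -> P w'.
  move=> wv w'v [h [hw hw']] Pw g gv gd.
  have E u : dist u w = (dist u w').+1 \/ dist u w' = (dist u w).+1.
    by have := dist_edge X_CAT0 h u; rewrite hw hw' !(dist_sym X_CAT0 _ u).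
  have [g0 g0v g0d] := descending X_CAT0 (nesym wv).
  have [E1|E1] := E v; first by apply: Pw => //; have := E (tgt g); lia.
  have [n ng0] : linked g0 by apply: Pw => //; lia.
  have [->|gg0] := pselect (g = g0); first by exists n.
  have [||||f' [e' [s _]]] := @quadrangle _ X_CAT0 g0 g w'.
  - by rewrite g0v.
  - exact: nesym.
  - by rewrite g0v; have := E (tgt g0); lia.
  - by rewrite gv.
  exists n.+1; apply: joined_rcons ng0 _ _ => //.
  exact: sq_link_adjacent s.
have Pe : P (tgt e).
  move=> g gv; rewrite -{1}ev (dist_src_tgt X_CAT0) => gd.
  have -> : g = e by apply: (edge_inj X_CAT0); [rewrite gv|apply: (dist_eq0 X_CAT0); lia].
  by exists 0%N; exact/joined0.
have ne g : src g = v -> tgt g <> v by move=> <- /esym; exact: (no_loop X_CAT0).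
have [n [p [p0 pn pw pv]]] := conn (tgt e) (tgt f) (ne _ ev) (ne _ fv).
suff Pp : forall i, (i <= n)%N -> P (p i).
  by apply: (Pp n) => //; rewrite pn (dist_refl X_CAT0) -fv (dist_src_tgt X_CAT0).
elim=> [|i IH] ni; first by rewrite p0.
by apply: (step (p i)); [exact/pv/ltnW|exact: pv|exact: pw|exact/IH/ltnW].
Qed.

End Links.

(** * A criterion for quasi-trees *)

Section GraphMetric.
Variable G : graph.
Hypothesis G_conn : gconnected G.
Implicit Types x y z : gvertex G.

Lemma gdistP x y : joined_in (@gadj G) setT (gdist x y) x y.
Proof.
rewrite /gdist; case: xgetP => [n -> [] //|H].
have [n xy] := G_conn (I : setT x) (I : setT y).
have ex : exists n, `[< joined_in (@gadj G) setT n x y >] by exists n; apply/asboolP.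
have [m /asboolP mP m_min] := ex_minnP ex.
by case: (H m); split=> // k /asboolP/m_min.
Qed.

Lemma gdist_le n x y : joined_in (@gadj G) setT n x y -> (gdist x y <= n)%N.
Proof.
move=> xy; have := gdistP x y; rewrite /gdist.
by case: xgetP => [m -> [_ m_min] _|//]; exact: m_min.
Qed.

Lemma gdistxx x : gdist x x = 0%N.
Proof. by apply/eqP; rewrite -leqn0; apply: gdist_le; apply/joined0. Qed.

Lemma gdist_sym x y : gdist x y = gdist y x.
Proof.
have K (u v : gvertex G) : (gdist u v <= gdist v u)%N.
  by apply: gdist_le; apply: joined_sym (gdistP v u); exact: gadj_sym.
by apply/eqP; rewrite eqn_leq !K.
Qed.

Lemma gdist_triangle x y z : (gdist x z <= gdist x y + gdist y z)%N.
Proof. by apply: gdist_le; apply: joined_cat (gdistP x y) (gdistP y z). Qed.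

Lemma gdist_adj x y : gadj x y -> (gdist x y <= 1)%N.
Proof. by move=> xy; apply: gdist_le; apply/joinedS; exists y; split=> //; apply/joined0. Qed.

Lemma gdist_adj_lip x y z : gadj x y -> (gdist z y <= (gdist z x).+1)%N.
Proof. by move=> /gdist_adj xy; have := gdist_triangle z x y; lia. Qed.

End GraphMetric.

Section TreeOfPieces.
Variable G : graph.
Hypothesis G_conn : gconnected G.
Variable o : gvertex G.
Implicit Types x y z : gvertex G.

Local Notation lev := (gdist o).

(** Joined outside the ball of radius n - 1 around o. *)
Definition joined_above n x y :=
  exists m, joined_in (@gadj G) [set z | (n <= lev z)%N] m x y.

Lemma joined_above_sym n x y : joined_above n x y -> joined_above n y x.
Proof. by case=> m xy; exists m; apply: joined_sym xy; exact: gadj_sym. Qed.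

Lemma joined_above_trans n x y z :
  joined_above n x y -> joined_above n y z -> joined_above n x z.
Proof. by move=> [m xy] [k yz]; exists (m + k)%N; exact: joined_cat xy yz. Qed.

Lemma joined_above_adj n x y : gadj x y -> (n <= lev x)%N -> (n <= lev y)%N ->
  joined_above n x y.
Proof.
by move=> xy nx ny; exists 1%N; apply/joinedS; exists y; split=> //; apply/joined0.
Qed.

Lemma joined_above_le n m x y : (n <= m)%N -> joined_above m x y -> joined_above n x y.
Proof. by move=> nm [k xy]; exists k; apply: joined_sub xy => z /=; exact: leq_trans. Qed.

(** The trace, on the sphere around o through x, of the component of x outside the
    open ball. *)
Definition piece x := [set y | lev y = lev x /\ joined_above (lev x) x y].

Lemma piece_refl x : piece x x.
Proof. by split=> //; exists 0%N; apply/joined0; split=> /=. Qed.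

Lemma piece_eq x y : piece x y -> piece x = piece y.
Proof.
case=> yx xy; apply/seteqP; split=> z [zl xz]; split; rewrite ?yx //.
- exact: joined_above_trans (joined_above_sym xy) xz.
- by rewrite zl.
- by apply: joined_above_trans xy _; rewrite -yx.
Qed.

Definition tree_vertex := {A : set (gvertex G) | exists x, A = piece x}.

Definition tpiece x : tree_vertex := exist _ (piece x) (ex_intro _ x erefl).

Lemma tpiece_eq (A : tree_vertex) x : sval A x -> A = tpiece x.
Proof.
case: A => A hA /= Ax; apply: eq_exist => /=.
by case: hA Ax => y ->; exact: piece_eq.
Qed.

Lemma tree_vertex_ex (A : tree_vertex) : exists x, sval A x.
Proof. by case: A => A [x hx]; exists x; rewrite /= hx; exact: piece_refl. Qed.

Definition tadj (A B : tree_vertex) :=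
  A <> B /\ exists x y, [/\ sval A x, sval B y & gadj x y].

Lemma tadj_sym A B : tadj A B -> tadj B A.
Proof.
move=> [AB [x [y [Ax By xy]]]]; split; first exact: nesym.
by exists y, x; split=> //; exact: gadj_sym.
Qed.

Lemma tadj_irr A : ~ tadj A A.
Proof. by case. Qed.

Definition piece_tree : graph := Graph tadj_sym tadj_irr.

Lemma tpiece_adj x y : gadj x y -> tpiece x = tpiece y \/ tadj (tpiece x) (tpiece y).
Proof.
move=> xy; have [->|ne] := pselect (tpiece x = tpiece y); first by left.
by right; split=> //; exists x, y; split=> //; exact: piece_refl.
Qed.

Lemma tadj_level A B x y : tadj A B -> sval A x -> sval B y -> gadj x y -> lev x <> lev y.
Proof.
move=> [AB _] Ax By xy E; apply: AB.
rewrite (tpiece_eq Ax) (tpiece_eq By); apply: tpiece_eq.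
split=> //=; apply: joined_above_adj; rewrite ?E //; exact: gadj_sym.
Qed.

Definition tlev (A : tree_vertex) := lev (sval (boolp.cid (tree_vertex_ex A))).

Lemma tlevE A x : sval A x -> tlev A = lev x.
Proof.
move=> Ax; rewrite /tlev; case: boolp.cid => y /= Ay.
by move: Ay; rewrite (tpiece_eq Ax) => -[].
Qed.

(** Adjacent pieces have distinct levels, and two walks descending from the same
    piece end in the same piece: go up, inside the piece A, and down again. *)
Lemma tree_parent_uniq A B C : tadj A B -> tadj A C ->
  (tlev B <= tlev A)%N -> (tlev C <= tlev A)%N -> B = C.
Proof.
move=> AB AC BA CA; have [_ [x [y [Ax By xy]]]] := AB.
have [_ [x' [y' [Ax' Cy' xy']]]] := AC.
have xyl := tadj_level AB Ax By xy; have xyl' := tadj_level AC Ax' Cy' xy'.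
rewrite (tlevE By) (tlevE Ax) in BA; rewrite (tlevE Cy') (tlevE Ax') in CA.
have xx' := tlevE Ax; rewrite (tlevE Ax') in xx'.
have := gdist_adj_lip G_conn o (gadj_sym xy).
have := gdist_adj_lip G_conn o (gadj_sym xy') => l l'.
have yy' : lev y' = lev y by lia.
rewrite (tpiece_eq By) (tpiece_eq Cy'); apply/esym/tpiece_eq; split=> //=.
have [_ xax'] : piece x x' by have := Ax'; rewrite (tpiece_eq Ax).
apply: (@joined_above_trans _ _ x'); first by apply: joined_above_adj (gadj_sym xy') _ _; lia.
apply: (@joined_above_trans _ _ x); last by apply: joined_above_adj xy _ _; lia.
by apply/joined_above_sym/(joined_above_le _ xax'); lia.
Qed.

Lemma tpiece_walk n x y : joined_in (@gadj G) setT n x y ->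
  exists2 m, (m <= n)%N & joined_in (@gadj piece_tree) setT m (tpiece x) (tpiece y).
Proof.
elim: n x => [|n IH] x; first by case/joined0=> _ <-; exists 0%N => //; apply/joined0.
case/joinedS=> z [_ xz /IH[m mn zy]].
have [->|xz'] := tpiece_adj xz; first by exists m => //; exact: leqW.
by exists m.+1 => //; apply/joinedS; exists (tpiece z); split.
Qed.

Lemma piece_tree_conn : gconnected piece_tree.
Proof.
move=> A B _ _; have [x Ax] := tree_vertex_ex A; have [y By] := tree_vertex_ex B.
rewrite (tpiece_eq Ax) (tpiece_eq By).
by have [m _ H] := tpiece_walk (gdistP G_conn x y); exists m.
Qed.

(** A vertex of maximal level in a cycle would have two distinct neighbors of
    smaller level. *)
Lemma piece_tree_is_tree : is_tree piece_tree.
Proof.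
split=> [|n p [n3 pw pn p_inj]]; first exact: piece_tree_conn.
have n0 : (0 < n)%N by lia.
have [i _ i_max] := @arg_maxnP _ (Ordinal n0) xpredT (fun i : 'I_n => tlev (p i)) isT.
have lt_in := ltn_ord i.
pose j := if i.+1 == n then 0%N else i.+1.
pose k := if i == 0%N :> nat then n.-1 else i.-1.
have jn : (j < n)%N by rewrite /j; case: eqP; lia.
have kn : (k < n)%N by rewrite /k; case: eqP; lia.
have pj : tadj (p i) (p j).
  rewrite /j; case: eqP => [E|_]; last exact: pw.
  by have := pw _ lt_in; rewrite E pn.
have pk : tadj (p i) (p k).
  apply: tadj_sym; rewrite /k; case: eqP => [->|E].
    by have := pw n.-1; rewrite (prednK n0) pn; apply.
  by have := pw i.-1; rewrite prednK; [apply|]; lia.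
have := tree_parent_uniq pj pk (i_max (Ordinal jn) isT) (i_max (Ordinal kn) isT).
by move/(p_inj _ _ jn kn); rewrite /j /k; case: eqP; case: eqP; lia.
Qed.

Variable D : nat.
Hypothesis piece_diam : forall x y, piece x y -> (gdist x y <= D)%N.

(** Each edge of the tree lifts to an edge of G, and between two lifts one moves
    inside a piece. *)
Lemma piece_tree_lift n (A B : tree_vertex) x y :
  joined_in (@gadj piece_tree) setT n A B -> sval A x -> sval B y ->
  (gdist x y <= n * D.+1 + D)%N.
Proof.
elim: n A x => [|n IH] A x.
  case/joined0=> _ -> Bx By; apply: piece_diam.
  by move: By; rewrite (tpiece_eq Bx).
case/joinedS=> C [_ [_ [x1 [z [Ax1 Cz xz]]]] CB] Ax By.
have := IH _ _ CB Cz By.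
have := gdist_triangle G_conn x x1 z; have := gdist_triangle G_conn x z y.
have := gdist_adj G_conn xz.
have : (gdist x x1 <= D)%N by apply: piece_diam; move: Ax1; rewrite (tpiece_eq Ax).
by rewrite mulSn; lia.
Qed.

End TreeOfPieces.

Section QuasiTree.
Import Order.TTheory GRing.Theory Num.Theory.

(** The map sending a vertex to its piece is a quasi-isometry onto the tree of
    pieces as soon as the pieces have bounded diameter. *)
Lemma quasi_tree_of_pieces (R : realType) (G : graph) (o : gvertex G) (D : nat) :
  gconnected G ->
  (forall x y, piece o x y -> (gdist x y <= D)%N) ->
  quasi_tree R G.
Proof.
move=> G_conn diam; split=> //; exists (piece_tree o).
split; first exact: piece_tree_is_tree.
have T_conn : gconnected (piece_tree o) by exact: piece_tree_conn.
exists (tpiece o), D.+1%:R%R, D%:R%R; split.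
- by rewrite ler1n.
- exact: ler0n.
- move=> x y; rewrite lerBlDr ler_pdivrMr ?ltr0n // -natrD -!natrM -natrD !ler_nat.
  have [m mn xy] := tpiece_walk o (gdistP G_conn x y).
  have lo := piece_tree_lift G_conn diam
    (gdistP T_conn (tpiece o x) (tpiece o y)) (piece_refl o x) (piece_refl o y).
  have := gdist_le T_conn xy.
  by move=> tm; apply/andP; split; nia.
- move=> A; have [x Ax] := tree_vertex_ex A; exists x.
  by rewrite (tpiece_eq Ax) gdistxx.
Qed.

End QuasiTree.

(** * Hyperplanes as bottlenecks *)

Section Hyperplanes.
Variable X : cubeComplex.
Implicit Types (a b c d e f g : edge X) (H K W : hyperplane X) (v : vertex X).

Definition dualH e : hyperplane X := exist _ (hyperplane_of e) (ex_intro _ e erefl).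

Lemma mem_dualH e : sval (dualH e) e.
Proof. exact: rst_refl. Qed.

Lemma dualH_parallel e f : parallel e f -> dualH e = dualH f.
Proof.
move=> ef; apply: eq_exist; apply/seteqP; split=> g /=; apply: rst_trans => //.
exact: rst_sym.
Qed.

Lemma dualH_mem H e : sval H e -> H = dualH e.
Proof.
case: H => A [f hA] /= Ae; apply: eq_exist => /=; move: Ae; rewrite hA => fe.
by have /dualH_parallel[] := fe.
Qed.

Lemma dualH_ex H : exists e, sval H e.
Proof. by case: H => A [e hA]; exists e; rewrite /= hA; exact: rst_refl. Qed.

Lemma dualH_erev e : dualH (erev e) = dualH e.
Proof. by apply/esym/dualH_parallel/rst_step; constructor. Qed.

Lemma link_adjacent_dualH e f : link_adjacent e f ->
  dualH e = dualH f \/ transverse (dualH e) (dualH f).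
Proof.
case=> q [<- <-].
have [?|ne] := pselect (dualH (link_vertex q ord0) = dualH (link_vertex q ord_max)).
  by left.
by right; split=> //; exists q, ord0, ord_max, (czero 2), (czero 2); split=> //; exact: mem_dualH.
Qed.

(** Each side of a square is parallel to one of the two sides starting at (0,0). *)
Lemma transverse_corner H K : transverse H K ->
  exists e f, [/\ sval H e, sval K f & src e = src f].
Proof.
case=> _ [q [i [j [x [y [_ Hq Kq]]]]]].
have E (L : hyperplane X) k z : sval L (cedge q k z) -> sval L (cedge q k (czero 2)).
  move=> /dualH_mem ->; apply: rst_step; exact: parallel_square.
exists (cedge q i (czero 2)), (cedge q j (czero 2)); split; [exact: E Hq|exact: E Kq|].
by rewrite !src_cedge; congr corner; apply/ffunP => k; rewrite !ffunE; do 2! case: ifP.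
Qed.

Section Separation.
Hypothesis X_CAT0 : CAT0 X.

(** Two parallel edges opposite in a square start at the ends of a third side. If this
    side is in the hyperplane of w then H crosses or equals that hyperplane. *)
Lemma closer_hyperplane w H a a' : dualH w <> H -> ~ transverse (dualH w) H ->
  sval H a -> sval H a' -> closer (src a) w = closer (src a') w.
Proof.
move=> wH wtH Ha Ha'.
have aa' : parallel a a' by move: Ha'; rewrite (dualH_mem Ha).
elim: aa' Ha {Ha'} => [e f ef|//|e f ef IH Hf|e f g ef IH fg IH' He].
- move=> He; case: (eqVneq (closer (src e) w) (closer (src f) w)) => // ne; exfalso.
  have [E|[E|[b [c h]]]] := parallel_cases ef.
  + subst f; rewrite src_erev in ne.
    have /dualH_parallel E := parallel_of_closer_neq X_CAT0 ne.
    by case: wH; rewrite -E; exact/esym/dualH_mem.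
  + by subst f; rewrite eqxx in ne.
  + have [E1 _ E2 _] := sq_ends h; rewrite E1 -E2 in ne.
    have /dualH_parallel E := parallel_of_closer_neq X_CAT0 ne.
    have [E3|] := link_adjacent_dualH (sq_link_adjacent h).
      by case: wH; rewrite -E -E3; exact/esym/dualH_mem.
    by rewrite E -(dualH_mem He) => /transverse_sym.
- by apply/esym/IH; rewrite (dualH_mem Hf); exact: rst_sym.
- by rewrite IH // IH' //; rewrite (dualH_mem He).
Qed.

(** Consecutive hyperplanes of the walk have edges with the same start, so the side
    of w can only change at a hyperplane which crosses or equals the one of w. *)
Lemma hyperplane_bottleneck (S : set (hyperplane X)) w n H K a b :
  joined_in (@transverse X) S n H K -> sval H a -> sval K b ->
  closer (src a) w <> closer (src b) w ->
  exists i Z, [/\ (i <= n)%N, joined_in (@transverse X) S i H Z,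
    joined_in (@transverse X) S (n - i) Z K & dualH w = Z \/ transverse (dualH w) Z].
Proof.
elim: n H a => [|n IH] H a HK Ha Kb ab.
  have [SH E] := (joined0 _ _ _ _).1 HK; subst K.
  exists 0%N, H; split=> //.
  by apply: contrapT => /not_orP[? ?]; apply: ab; exact: closer_hyperplane Ha Kb.
have [SH SK] := joined_ends HK.
have [nearH|/not_orP[? ?]] := pselect (dualH w = H \/ transverse (dualH w) H).
  by exists 0%N, H; split=> //; exact/joined0.
have [L [_ HL LK]] := (joinedS _ _ _ _ _).1 HK.
have [c [d [Hc Ld cd]]] := transverse_corner HL.
have [|i [Z [ni LZ ZK nearZ]]] := IH L d LK Ld Kb.
  by rewrite -cd -(@closer_hyperplane w H a c).
by exists i.+1, Z; split=> //; apply/joinedS; exists L.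
Qed.

Hypothesis X_nocut : forall v, ~ cut_vertex v.

(** * Distances in the crossing graph *)

Section Contact.
Variable N : nat.
Hypothesis X_N : forall v, [set w | neighbor v w] #<= `I_N.

Lemma contact_joined e f : src e = src f ->
  exists2 n, (n <= N)%N & joined_in (@transverse X) setT n (dualH e) (dualH f).
Proof.
move=> ef; set v := src f.
have [n ne] := link_connected X_CAT0 (@X_nocut v) ef erefl.
have [|m /ltnW mN {}ne] := joined_short (N := N) _ ne.
  apply: card_le_trans (X_N v).
  apply: (set_inj_card_le (f := @tgt X)) => [g g' /= gv g'v|g /= gv].
    by apply: (edge_inj X_CAT0); rewrite gv.
  by exists g.
suff [k km kef] : exists2 k, (k <= m)%N & joined_in (@transverse X) setT k (dualH e) (dualH f).
  by exists k => //; exact: leq_trans mN.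
elim: m e {ef mN} ne => [|m IH] e.
  by case/joined0=> _ ->; exists 0%N => //; exact/joined0.
case/joinedS=> g [_ eg /IH[k km gf]].
have [->|t] := link_adjacent_dualH eg; first by exists k => //; exact: leqW.
by exists k.+1 => //; apply/joinedS; exists (dualH g).
Qed.

Lemma crossing_graph_connected : gconnected (crossing_graph X).
Proof.
move=> H K _ _; have [e He] := dualH_ex H; have [f Kf] := dualH_ex K.
rewrite (dualH_mem He) (dualH_mem Kf).
have [s] := edge_path_ex X_CAT0 (src e) (src f).
elim: s (e) => [|g s IH] e' /=.
  by move=> /contact_joined[n _ nef]; exists n.
case=> /esym /contact_joined[n _ eg]; rewrite -src_erev => /IH[m].
by rewrite dualH_erev => gf; exists (n + m)%N; exact: joined_cat eg gf.
Qed.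

Local Notation cdist := (@gdist (crossing_graph X)).
Let tri := gdist_triangle crossing_graph_connected.
Let dsym := gdist_sym crossing_graph_connected.

Lemma contact_gdist e f : src e = src f -> (cdist (dualH e) (dualH f) <= N)%N.
Proof.
move=> /contact_joined[n nN ef]; apply: leq_trans nN.
exact: gdist_le crossing_graph_connected _ _ _ ef.
Qed.

Lemma near_gdist W Z : W = Z \/ transverse W Z -> (cdist W Z <= 1)%N.
Proof.
case=> [->|WZ]; first by rewrite (gdistxx crossing_graph_connected).
exact: (gdist_adj crossing_graph_connected).
Qed.

(** Let n be the distance from o to H and K. The bottleneck applied to the walk from
    H to K gives cdist o (dualH w) >= n - 1; applied to a geodesic from o to H or K it
    gives a vertex of this geodesic at distance at most 1 from dualH w, hence at
    distance at least n - 2 from o and at most 2 from H or K. *)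
Lemma separating_close o H K e f w : @piece (crossing_graph X) o H K ->
  sval H e -> sval K f -> closer (src e) w <> closer (src f) w ->
  (cdist H (dualH w) <= 3)%N || (cdist K (dualH w) <= 3)%N.
Proof.
move=> [KH [m HK]] He Kf ef.
have [i [Z [_ HZ _ /near_gdist dZ]]] := hyperplane_bottleneck HK He Kf ef.
have [_ /= oZ] := joined_ends HZ.
have oW : (cdist o H <= (cdist o (dualH w)).+1)%N by have := tri o (dualH w) Z; lia.
have [c oc] := dualH_ex o.
have close L g : cdist o L = cdist o H -> sval L g -> closer (src c) w <> closer (src g) w ->
    (cdist L (dualH w) <= 3)%N.
  move=> LH Lg cg.
  have oL := gdistP crossing_graph_connected o L.
  have [j [Y [jn oY YL /near_gdist dY]]] := hyperplane_bottleneck oL oc Lg cg.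
  have := gdist_le crossing_graph_connected oY.
  have := gdist_le crossing_graph_connected YL.
  have := tri o Y (dualH w); have := tri L Y (dualH w).
  by rewrite (dsym L Y) (dsym Y (dualH w)); lia.
have [ce|ce] := pselect (closer (src c) w = closer (src e) w).
  by rewrite (close K f) ?orbT //; rewrite ce.
by rewrite (close H e).
Qed.

(** Walking along s, the hyperplanes are near H until the first one which is near K,
    or until the end of s, where K itself is met. *)
Lemma contact_chain H K s v f e : edge_path v s (src f) -> src e = v ->
  (cdist H (dualH e) <= 3)%N -> sval K f ->
  all (fun g => (cdist H (dualH g) <= 3)%N || (cdist K (dualH g) <= 3)%N) s ->
  (cdist H K <= N + 6)%N.
Proof.
elim: s v e => [|g s IH] v e /=.
  move=> vf ev He Kf _; have := contact_gdist (etrans ev vf).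
  by rewrite -(dualH_mem Kf); have := tri H (dualH e) K; lia.
case=> gv sp ev He Kf /andP[/orP[Hg|Kg] all_s].
  by apply: (IH _ (erev g) sp) => //; rewrite ?src_erev ?dualH_erev.
have := contact_gdist (etrans ev (esym gv)).
have := tri H (dualH e) (dualH g); have := tri H (dualH g) K.
by rewrite (dsym (dualH g) K); lia.
Qed.

Lemma piece_crossing_graph_diam o H K :
  @piece (crossing_graph X) o H K -> (cdist H K <= N + 6)%N.
Proof.
move=> oHK; have [e He] := dualH_ex H; have [f Kf] := dualH_ex K.
have [s [sp sr _]] := geodesic X_CAT0 (src e) (src f).
apply: (contact_chain sp erefl _ Kf).
  by rewrite -(dualH_mem He) (gdistxx crossing_graph_connected).
apply/(all_nthP e) => i si; apply: separating_close oHK He Kf _.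
have E := cat_take_drop i s; rewrite (drop_nth e si) in E.
rewrite -E in sp sr.
by have /andP[-> /negbTE ->] := geodesic_separates X_CAT0 sp sr.
Qed.

End Contact.

End Separation.

End Hyperplanes.

(** * The crossing graph is a quasi-tree *)

Theorem propositionA2 (R : realType) (X : cubeComplex)
  (X_CAT0 : CAT0 X)
  (X_ulf : uniformly_locally_finite X)
  (X_nocut : forall v : vertex X, ~ cut_vertex v) :
  quasi_tree R (crossing_graph X).
Proof.
have [N X_N] := X_ulf.
have [[o _]|no] := pselect (exists o : hyperplane X, True).
  apply: (@quasi_tree_of_pieces R (crossing_graph X) o (N + 6)).
    exact: crossing_graph_connected X_N.
  by move=> H K; exact: piece_crossing_graph_diam.
(* The crossing graph of a point is empty, which is a tree. *)
have empty : hyperplane X -> False by move=> o; apply: no; exists o.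
have conn : gconnected (crossing_graph X) by move=> H; case: (empty H).
split=> //; exists (crossing_graph X); split.
  by split=> // n p; case: (empty (p 0%N)).
by exists id, 1%R, 0%R; split=> // H; case: (empty H).
Qed.
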